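(* Let \[ A_1=\begin{bmatrix}1&0&0\\0&0&0\\0&0&0\end{bmatrix},\quad A_2=\begin{bmatrix}0&0&0\\0&1&0\\0&0&0\end{bmatrix},\quad A_3=\begin{bmatrix}0&-1/2&0\\-1/2&0&0\\0&0&1\end{bmatrix}, \] $b_1=b_2=b_3=0\in\mathbb{R}^3$, $c_1=c_2=-1$, $c_3=0$, and \[ S=\left\{x\in\mathbb{R}^3 : \begin{bmatrix}x\\1\end{bmatrix}^\top\begin{bmatrix}A_i&b_i\\ b_i^\top&c_i\end{bmatrix}\begin{bmatrix}x\\1\end{bmatrix}<0,\ i\in\{1,2,3\}\right\}. \] For $\lambda\in\mathbb{R}^3_+$ let \[ S_\lambda=\left\{x\in\mathbb{R}^3 : \begin{bmatrix}x\\1\end{bmatrix}^\top\left(\sum_{i=1}^3\lambda_i\begin{bmatrix}A_i&b_i\\ b_i^\top&c_i\end{bmatrix}\right)\begin{bmatrix}x\\1\end{bmatrix}<0\right\}. \] Then: (a) $\mathrm{conv}(S)\neq\mathbb{R}^3$; (b) there is no $\theta\in\mathbb{R}^3$ such that $\sum_{i=1}^3\theta_i\begin{bmatrix}A_i&b_i\\ b_i^\top&c_i\end{bmatrix}\succ0$; (c) \[ \mathrm{conv}(S)\subsetneq\bigcap\{S_\lambda : \lambda\in\mathbb{R}^3_+,\ S_\lambda\supseteq\mathrm{conv}(S)\}. \] In particular, $\mathrm{conv}(S)\neq\bigcap_{\lambda\in\Omega}S_\lambda$, where $\Omega=\{\lambda\in\mathbb{R}^3_+ : S_\lambda\supseteq\mathrm{conv}(S)\text{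 and }\nu(S_\lambda)\leq1\}$.
   Context: $\mathbb{R}^3_+$ is the set of vectors in $\mathbb{R}^3$ with all entries nonnegative. For a symmetric matrix $M$, $M\succ0$ means positive definite. $\mathrm{conv}$ denotes the convex hull. $\nu(S_\lambda)$ denotes the number of negative eigenvalues (with multiplicity) of $\sum_{i=1}^3\lambda_iA_i$. *)

(* Defs.v *)
From HB Require Import structures.
From mathcomp Require Import all_boot all_order all_algebra.
From mathcomp Require Import classical_sets reals convex.
From mathcomp Require Import polyrcf.

Set Implicit Arguments.
Unset Strict Implicit.
Unset Printing Implicit Defensive.

Import Order.TTheory GRing.Theory Num.Theory.

Local Open Scope classical_set_scope.
Local Open Scope ring_scope.

Definition convex_hull (R : realType) (V : lmodType R) (X : set V) : set V :=
  smallest (@convex_set R V) X.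

Definition posdefmx (R : realType) (n : nat) (M : 'M[R]_n) : Prop :=
  M \is symmetricmx /\
  forall x : 'cV[R]_n, x != 0 -> 0 < (x^T *m M *m x) 0 0.

(* Negative eigenvalues are counted with algebraic multiplicity. Since
   [rootsR] lists the real roots only, this counts all of them when the
   spectrum of [M] is real, in particular when [M] is symmetric. *)
Definition num_neg_eigenvalues (R : realType) (n : nat) (M : 'M[R]_n) : nat :=
  (\sum_(a <- rootsR (char_poly M) | (a < 0)%R) mup a (char_poly M))%N.

Definition nonneg_vec (R : realType) (n : nat) : set 'cV[R]_n :=
  [set l | forall i, 0 <= l i 0].

Definition homogenized_mx (R : realType) (n : nat)
    (A : 'M[R]_n) (b : 'cV[R]_n) (c : R) : 'M[R]_(n + 1) :=
  block_mx A b b^T c%:M.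

(* {x | [x; 1]^T Q [x; 1] < 0} *)
Definition quadric_lt0 (R : realType) (n : nat) (Q : 'M[R]_(n + 1)) :
    set 'cV[R]_n :=
  [set x | ((col_mx x 1%:M)^T *m Q *m col_mx x (1%:M : 'M_1)) 0 0 < 0].

Definition lincomb_mx (R : realType) (m n p : nat)
    (M : 'I_m -> 'M[R]_(n, p)) (l : 'cV[R]_m) : 'M[R]_(n, p) :=
  \sum_(i < m) l i 0 *: M i.

Definition mx3_of_rows (R : realType) (rows : seq (seq R)) : 'M[R]_3 :=
  \matrix_(i, j) nth 0 (nth [::] rows i) j.

Definition ex_A1 (R : realType) : 'M[R]_3 := mx3_of_rows
  [:: [:: 1; 0; 0];
      [:: 0; 0; 0];
      [:: 0; 0; 0]].

Definition ex_A2 (R : realType) : 'M[R]_3 := mx3_of_rows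
  [:: [:: 0; 0; 0];
      [:: 0; 1; 0];
      [:: 0; 0; 0]].

Definition ex_A3 (R : realType) : 'M[R]_3 := mx3_of_rows
  [:: [:: 0; - (1 / 2); 0];
      [:: - (1 / 2); 0; 0];
      [:: 0; 0; 1]].

Definition ex_A (R : realType) (i : 'I_3) : 'M[R]_3 :=
  tnth [tuple ex_A1 R; ex_A2 R; ex_A3 R] i.

Definition ex_b (R : realType) (i : 'I_3) : 'cV[R]_3 := 0.

Definition ex_c (R : realType) (i : 'I_3) : R := tnth [tuple -1; -1; 0] i.

Definition ex_Q (R : realType) (i : 'I_3) : 'M[R]_(3 + 1) :=
  homogenized_mx (ex_A R i) (ex_b R i) (ex_c R i).

Definition ex_S (R : realType) : set 'cV[R]_3 :=
  [set x | forall i, quadric_lt0 (ex_Q R i) x].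
Arguments ex_S R : clear implicits.

Definition ex_Sl (R : realType) (l : 'cV[R]_3) : set 'cV[R]_3 :=
  quadric_lt0 (lincomb_mx (ex_Q R) l).

(* nu(S_l): the matrix involved is sum_i l_i A_i, without the homogenizing row
   and column, so this is a function of the multiplier l, not of the set S_l. *)
Definition ex_nu (R : realType) (l : 'cV[R]_3) : nat :=
  num_neg_eigenvalues (lincomb_mx (ex_A R) l).

Definition ex_Omega (R : realType) : set 'cV[R]_3 :=
  [set l | [/\ nonneg_vec l, convex_hull (ex_S R) `<=` ex_Sl l
             & (ex_nu l <= 1)%N]].
Arguments ex_Omega R : clear implicits.

(* Main.v *)
Require Import Defs.
From HB Require Import structures.
From mathcomp Require Import all_boot all_order all_algebra.
From mathcomp Require Import classical_sets reals convex.
From mathcomp Require Import unstable interval_inference ring lra.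

Set Implicit Arguments.
Unset Strict Implicit.
Unset Printing Implicit Defensive.

Import Order.TTheory GRing.Theory Num.Theory.

Local Open Scope classical_set_scope.
Local Open Scope ring_scope.

(** Writing a point of space as (x, y, z), the set S is given by
    |x| < 1, |y| < 1 and z^2 < xy: an open convex body in the octants x, y > 0
    together with its reflection through the origin.

    - Everything except the second assertion is witnessed by the single point
      p = (1/2, -1/2, 0).  On S the coordinates x and y have the same sign and
      lie in ]-1, 1[, hence x - y < 1; this open half-space is convex, so it
      contains conv(S), but it misses p ([notin_conv_exS]).
    - On the other hand p lies in every S_l containing conv(S)
      ([in_exSl_of_conv_sub]).  The two halves of S produce points of conv(S)
      on the z-axis, arbitrarily close to (0, 0, 1): the midpoint of
      (s, s, r) and (-s, -s, r) is (0, 0, r) whenever r < s < 1.  If such a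
      point belongs to S_l, then l_3 r^2 < l_1 + l_2, so that l_3 cannot be
      much larger than l_1 + l_2; but p belongs to S_l as soon as
      l_3 < 3 (l_1 + l_2).
    - Restricting the multipliers to Omega can only enlarge the intersection,
      so p separates it from conv(S) as well.
    - No combination of the homogenized matrices is positive definite, since
      its diagonal entries t_1, t_2 and -(t_1 + t_2) would all be positive. *)

Definition vec3 (R : realType) (a b c : R) : 'cV[R]_3 :=
  \col_i nth 0 [:: a; b; c] i.

(** The last coordinate [z] is kept general: membership in S_l needs z = 1,
    while the failure of positive definiteness also needs z = 0. *)
Lemma exQ_formE (R : realType) (i : 'I_3) (x : 'cV[R]_3) (z : R) :
  ((col_mx x z%:M)^T *m ex_Q R i *m col_mx x (z%:M : 'M_1)) 0 0 =
  nth 0 [:: x 0 0 ^+ 2 - z ^+ 2; x 1 0 ^+ 2 - z ^+ 2;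
            x 2%:R 0 ^+ 2 - x 0 0 * x 1 0] i.
Proof.
rewrite /ex_Q /homogenized_mx /ex_b tr_col_mx mul_row_block mul_row_col.
rewrite trmx0 !mulmx0 addr0 add0r.
have -> : x 2%:R 0 = x (lift 0 (lift 0 0)) 0 by congr (x _ _); apply: val_inj.
have -> : x 1 0 = x (lift 0 0) 0 by congr (x _ _); apply: val_inj.
rewrite /ex_A /ex_c tr_scalar_mx -!scalar_mxM.
case: i => [[|[|[|//]]] lti];
  rewrite !(tnth_nth 0) /= !mxE !big_ord_recl !big_ord0 /= !mxE;
  rewrite !big_ord_recl !big_ord0 /= !mxE /=; by field.
Qed.

Lemma lincomb_exQ_formE (R : realType) (l : 'cV[R]_3) (x : 'cV[R]_3) (z : R) :
  ((col_mx x z%:M)^T *m lincomb_mx (ex_Q R) l *m col_mx x (z%:M : 'M_1)) 0 0 =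
  l 0 0 * (x 0 0 ^+ 2 - z ^+ 2) + l 1 0 * (x 1 0 ^+ 2 - z ^+ 2) +
  l 2%:R 0 * (x 2%:R 0 ^+ 2 - x 0 0 * x 1 0).
Proof.
rewrite /lincomb_mx mulmx_sumr mulmx_suml summxE.
under eq_bigr => i _ do rewrite -scalemxAr -scalemxAl mxE exQ_formE.
rewrite !big_ord_recl big_ord0 /= addr0 addrA.
by congr (_ * _ + l _ 0 * _ + l _ 0 * _); apply: val_inj.
Qed.

Lemma exSlE (R : realType) (l x : 'cV[R]_3) :
  ex_Sl l x <->
  l 0 0 * (x 0 0 ^+ 2 - 1) + l 1 0 * (x 1 0 ^+ 2 - 1) +
  l 2%:R 0 * (x 2%:R 0 ^+ 2 - x 0 0 * x 1 0) < 0.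
Proof. by rewrite /ex_Sl /quadric_lt0 /= lincomb_exQ_formE expr1n. Qed.

Lemma exSE (R : realType) (x : 'cV[R]_3) :
  ex_S R x <-> [/\ x 0 0 ^+ 2 < 1, x 1 0 ^+ 2 < 1 &
                   x 2%:R 0 ^+ 2 < x 0 0 * x 1 0].
Proof.
rewrite /ex_S /quadric_lt0 /=; split=> [Sx | [x0 x1 x2] i].
  have := (Sx 0, Sx 1, Sx 2%:R); rewrite !exQ_formE /= expr1n !subr_lt0.
  by case=> -[].
rewrite exQ_formE expr1n.
by case: i => [[|[|[|//]]] lti] /=; rewrite subr_lt0.
Qed.

Lemma convex_set_halfspace (R : realType) (n : nat) (u : 'rV[R]_n) (c : R) :
  convex_set [set x : 'cV[R]_n | (u *m x) 0 0 < c].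
Proof.
apply/convex_setW => x y /set_mem /= ux /set_mem /= uy k k0 k1.
apply/mem_set; rewrite /conv /= mulmxDr -!scalemxAr /onem.
by rewrite mxE [X in X + _]mxE [X in _ + X]mxE; nra.
Qed.

Lemma notin_conv_exS (R : realType) :
  ~ convex_hull (ex_S R) (vec3 (1 / 2) (- (1 / 2)) 0).
Proof.
pose u : 'rV[R]_3 := \row_i nth 0 [:: 1; -1; 0] i.
have uE x : (u *m x) 0 0 = x 0 0 - x 1 0.
  rewrite mxE !big_ord_recl big_ord0 !mxE /=.
  rewrite (_ : lift 0 0 = 1); first by ring.
  exact: val_inj.
have sub : convex_hull (ex_S R) `<=` [set x | (u *m x) 0 0 < 1].
  apply: smallest_sub; first exact: convex_set_halfspace.
  move=> x /exSE [x0 x1 x2] /=; rewrite uE.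
  have x01 : 0 < x 0 0 * x 1 0 by apply: le_lt_trans x2; exact: sqr_ge0.
  have [x1_lt1 x1_gtN1] : x 1 0 < 1 /\ -1 < x 1 0 by split; nra.
  have [x0_lt1 x0_gtN1] : x 0 0 < 1 /\ -1 < x 0 0 by split; nra.
  by case: (lerP (x 1 0) 0) => ?; nra.
by move=> /sub /=; rewrite uE !mxE /=; lra.
Qed.

Lemma convex_hull_midpoint (R : realType) (V : lmodType R) (X : set V)
    (x y : V) : X x -> X y -> convex_hull X (2^-1 *: (x + y)).
Proof.
move=> Xx Xy A /= [cA XA].
have half_ge0 : 0 <= 2^-1 :> R by lra.
have half_le1 : 2^-1 <= 1 :> R by lra.
pose half : {i01 R} := Itv01 half_ge0 half_le1.
have /set_mem := cA x y half (mem_set (XA _ Xx)) (mem_set (XA _ Xy)).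
rewrite /conv /= /onem scalerDr.
by congr (A (_ + _ *: _)); field.
Qed.

(** The point (0, 0, 3/4) of conv(S) forces l_3 < 16/9 (l_1 + l_2), and the
    conclusion amounts to l_3 < 3 (l_1 + l_2).  Both follow from the same
    inequality, because l_3 >= 0 makes l_1 + l_2 positive. *)
Lemma in_exSl_of_conv_sub (R : realType) (l : 'cV[R]_3) :
  nonneg_vec l -> convex_hull (ex_S R) `<=` ex_Sl l ->
  ex_Sl l (vec3 (1 / 2) (- (1 / 2)) 0).
Proof.
move=> l0 sub.
have S1 : ex_S R (vec3 (4 / 5) (4 / 5) (3 / 4)).
  by apply/exSE; rewrite !mxE /=; split; lra.
have S2 : ex_S R (vec3 (- (4 / 5)) (- (4 / 5)) (3 / 4)).
  by apply/exSE; rewrite !mxE /=; split; lra.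
have /exSlE := sub _ (convex_hull_midpoint S1 S2).
rewrite exSlE !mxE /=.
have := l0 0; have := l0 1; have := l0 2%:R.
lra.
Qed.

Lemma lincomb_exQ_not_posdef (R : realType) (theta : 'cV[R]_3) :
  ~ posdefmx (lincomb_mx (ex_Q R) theta).
Proof.
case=> _ pos.
have form_gt0 (x : 'cV[R]_3) (z : R) :
  (x != 0) || (z != 0) ->
  0 < theta 0 0 * (x 0 0 ^+ 2 - z ^+ 2) + theta 1 0 * (x 1 0 ^+ 2 - z ^+ 2) +
      theta 2%:R 0 * (x 2%:R 0 ^+ 2 - x 0 0 * x 1 0).
  move=> xz; rewrite -lincomb_exQ_formE; apply: pos.
  apply: contraTneq xz => /eqP; rewrite col_mx_eq0 => /andP[-> /eqP z0].
  by move/matrixP/(_ 0 0): z0; rewrite !mxE /= mulr1n => ->; rewrite eqxx.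
have vec3_neq0 (a b c : R) : (a != 0) || (b != 0) -> vec3 a b c != 0.
  apply: contraTneq => /matrixP v0.
  have := (v0 0 0, v0 1 0); rewrite !mxE /= => -[-> ->].
  by rewrite eqxx.
have := form_gt0 (vec3 1 0 0) 0; rewrite vec3_neq0 ?oner_eq0 // => /(_ isT).
have := form_gt0 (vec3 0 1 0) 0.
rewrite vec3_neq0 ?oner_eq0 ?orbT // => /(_ isT).
have := form_gt0 0 1; rewrite oner_eq0 orbT => /(_ isT).
by rewrite !mxE /=; lra.
Qed.

Theorem proposition3 (R : realType) :
  [/\ convex_hull (ex_S R) <> setT,
      ~ (exists theta : 'cV[R]_3, posdefmx (lincomb_mx (ex_Q R) theta)),
      convex_hull (ex_S R) `<`
        \bigcap_(l in [set l | nonneg_vec l /\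
                               convex_hull (ex_S R) `<=` ex_Sl l]) ex_Sl l
    & convex_hull (ex_S R) <> \bigcap_(l in ex_Omega R) ex_Sl l].
Proof.
have notin_p := @notin_conv_exS R.
split.
- by move=> convT; apply: notin_p; rewrite convT.
- by case=> theta /lincomb_exQ_not_posdef.
- split; first by move=> x Cx l [_ subl]; exact: subl.
  move=> sub; apply: notin_p; apply: (sub (vec3 _ _ _)) => l [l0 subl].
  exact: in_exSl_of_conv_sub.
- move=> eq_conv; apply: notin_p; rewrite eq_conv => l [l0 subl _].
  exact: in_exSl_of_conv_sub.
Qed.
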